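(* Let $A\in\mathbf{M}_n(\mathbb{C})$. If $z_0\in\mathbb{C}$ is an interior point of $W(A)$, then $$\liminf_{\epsilon\to 0^+}\ \frac{1}{\epsilon^2}\,\mu_A\bigl(\{z\in\mathbb{C} : |z-z_0|\le\epsilon\}\bigr)\;>\;0 .$$
   Context: $\mathbf{M}_n(\mathbb{C})$ is the space of complex $n\times n$ matrices; $\langle x,y\rangle=y^*x$ on $\mathbb{C}^n$, and $\partial\mathbb{B}^n$ is the unit sphere of $\mathbb{C}^n$. The numerical range of $A$ is $W(A)=\{\langle Ax,x\rangle : x\in\partial\mathbb{B}^n\}\subset\mathbb{C}$. The numerical measure $\mu_A$ is the Borel probability measure on $\mathbb{C}$ which is the image, under the map $x\mapsto\langle Ax,x\rangle$, of the normalized (probability) Euclidean surface measure on $\partial\mathbb{B}^n$. *)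

(* Defs.v *)
From HB Require Import structures.
From mathcomp Require Import all_boot all_order all_algebra complex.
From mathcomp Require Import all_classical all_reals all_analysis.
From mathcomp Require Import measurable_realfun ring lra.
Set Implicit Arguments.
Unset Strict Implicit.
Unset Printing Implicit Defensive.
Import Order.TTheory GRing.Theory Num.Theory numFieldNormedType.Exports.

Local Open Scope classical_set_scope.
Local Open Scope ring_scope.
Local Open Scope complex_scope.

Section lebesgue_cons.
Context {R : realType} {m : nat}.
Local Notation RR := (measurableTypeR R).
Variable mu : {sigma_finite_measure set (m.-tuple RR) -> \bar R}.

Definition cons_pair (p : RR * m.-tuple RR) : m.+1.-tuple RR :=
  [tuple of p.1 :: p.2].

Let uncons (t : m.+1.-tuple RR) : RR * m.-tuple RR :=
  (thead t, [tuple of behead t]).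

Let cons_pairK : cancel cons_pair uncons.
Proof. by move=> [x t]; congr (_, _); apply/val_inj. Qed.

Lemma measurable_cons_pair : measurable_fun setT cons_pair.
Proof. exact: measurable_cons. Qed.

HB.instance Definition _ := isMeasurableFun.Build _ _ _ _ cons_pair
  measurable_cons_pair.

Let measurable_uncons : measurable_fun setT uncons.
Proof.
apply: measurable_fun_pair; first exact: measurable_tnth.
exact: measurable_behead.
Qed.

Definition lebesgue_cons : set (m.+1.-tuple RR) -> \bar R :=
  pushforward (lebesgue_measure \x mu)%E cons_pair.

Let lebesgue_cons0 : lebesgue_cons set0 = 0%E.
Proof. exact: measure0. Qed.

Let lebesgue_cons_ge0 A : (0 <= lebesgue_cons A)%E.
Proof. exact: measure_ge0. Qed.

Let lebesgue_cons_sigma_additive : semi_sigma_additive lebesgue_cons.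
Proof. exact: measure_semi_sigma_additive. Qed.

HB.instance Definition _ := isMeasure.Build _ _ _ lebesgue_cons
  lebesgue_cons0 lebesgue_cons_ge0 lebesgue_cons_sigma_additive.

Let lebesgue_cons_sigma_finite : sigma_finite setT lebesgue_cons.
Proof.
have /sigma_finiteP[F [FT ndF Foo]] :=
  @sigma_finiteT _ _ _ [the {sigma_finite_measure set RR -> \bar R} of
                        lebesgue_measure].
have /sigma_finiteP[G [GT ndG Goo]] := sigma_finiteT mu.
exists (fun k => uncons @^-1` (F k `*` G k)) => [|k].
  rewrite -preimage_bigcup (_ : \bigcup_k _ = setT) ?preimage_setT//.
  apply/seteqP; split=> // -[x t] _.
  have [i _ Fx] : (\bigcup_k F k) x by rewrite -FT.
  have [j _ Gt] : (\bigcup_k G k) t by rewrite -GT.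
  exists (maxn i j) => //; split => /=.
  - by move: x Fx; exact/subsetPset/ndF/leq_maxl.
  - by move: t Gt; exact/subsetPset/ndG/leq_maxr.
have [mF Fk] := Foo k; have [mG Gk] := Goo k; split.
  rewrite -[X in measurable X]setTI; apply: measurable_uncons => //.
  exact: measurableX.
rewrite /lebesgue_cons /pushforward -comp_preimage.
rewrite (_ : uncons \o cons_pair = id); last exact/funext/cons_pairK.
by rewrite preimage_id product_measure1E// lte_mul_pinfty// ge0_fin_numE.
Qed.

HB.instance Definition _ := Measure_isSigmaFinite.Build _ _ _ lebesgue_cons
  lebesgue_cons_sigma_finite.

End lebesgue_cons.

Fixpoint lebesgue_tuple {R : realType} (m : nat) :
    {sigma_finite_measure set (m.-tuple (measurableTypeR R)) -> \bar R} :=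
  match m with
  | 0 => \d_[tuple]
  | m'.+1 => lebesgue_cons (lebesgue_tuple m')
  end.

Section surface_measure.
Context {R : realType}.
Local Notation RR := (measurableTypeR R).

Definition enorm m (t : m.-tuple RR) : R :=
  Num.sqrt (\sum_(i < m) tnth t i ^+ 2).

Definition eball m : set (m.-tuple RR) := [set t | enorm t <= 1].

Definition radial m (t : m.-tuple RR) : m.-tuple RR :=
  [tuple (enorm t)^-1 * tnth t i | i < m].

(* Normalized area on the unit sphere of R^m by the cone construction: the area
   of E relative to the sphere is the volume of the cone over E relative to the
   unit ball. For m > 0 the origin, which radial fixes, is negligible. *)
Definition surface_measure m (E : set (m.-tuple RR)) : \bar R :=
  (lebesgue_tuple m (@eball m `&` @radial m @^-1` E) *
   (fine (lebesgue_tuple m (@eball m)))^-1%:E)%E.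

Lemma enorm_ge0 m (t : m.-tuple RR) : 0 <= enorm t.
Proof. exact: sqrtr_ge0. Qed.

Lemma enorm_radial m (t : m.-tuple RR) : enorm t != 0 -> enorm (radial t) = 1.
Proof.
move=> t0; rewrite /enorm.
under eq_bigr do rewrite tnth_mktuple exprMn.
rewrite -mulr_sumr sqrtrM ?sqr_ge0// sqrtr_sqr.
by rewrite ger0_norm ?invr_ge0 ?enorm_ge0// mulVf.
Qed.

Lemma measurable_enorm m : measurable_fun setT (@enorm m).
Proof.
apply: (@measurableT_comp _ _ _ _ _ _ (@Num.sqrt R)).
  by apply: continuous_measurable_fun; exact: sqrt_continuous.
by apply: measurable_sum => i; apply: measurable_funX; exact: measurable_tnth.
Qed.

Lemma measurable_eball m : measurable (@eball m).
Proof.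
rewrite -[X in measurable X]setTI.
rewrite (_ : @eball m = @enorm m @^-1` `]-oo, 1]).
  by apply: measurable_enorm => //; exact: measurable_itv.
by apply/seteqP; split => t; rewrite /eball /= in_itv.
Qed.

Lemma measurable_radial m : measurable_fun setT (@radial m).
Proof.
apply/measurable_fun_tnthP => i.
rewrite (_ : _ \o _ = fun t => (enorm t `^ (-1)) * tnth t i).
  apply: measurable_funM; last exact: measurable_tnth.
  apply: (@measurableT_comp _ _ _ _ _ _ (@powR R ^~ (-1))).
    exact: measurable_powR.
  exact: measurable_enorm.
by apply/funext => t /=; rewrite tnth_mktuple powR_inv1 ?enorm_ge0.
Qed.

Definition cube (r : R) m : set (m.-tuple RR) :=
  [set t | forall i, - r <= tnth t i <= r].

Lemma lebesgue_tuple_cube (r : R) m : 0 < r ->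
  measurable (@cube r m) /\ lebesgue_tuple m (@cube r m) = ((r *+ 2) ^+ m)%:E.
Proof.
move=> r0; elim: m => [|m [mc IH]].
  have -> : @cube r 0 = setT by apply/seteqP; split => // t _ [].
  by split => //=; rewrite diracT.
have E : @cons_pair R m @^-1` @cube r m.+1 = `[- r, r]%classic `*` @cube r m.
  apply/seteqP; split => -[x t] /=.
    move=> H; split => [|i] /=; first by have := H ord0; rewrite in_itv.
    by have := H (lift ord0 i); rewrite tnthS.
  rewrite in_itv/= => -[xr H] i.
  by case: (unliftP ord0 i) => [j|] ->; rewrite ?tnthS.
split.
  rewrite (_ : @cube r m.+1 = \bigcap_(i in [set: 'I_m.+1])
             ((@tnth m.+1 RR)^~ i @^-1` `[- r, r]%classic)).
    apply: fin_bigcap_measurable => //.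
    move=> i _.
    rewrite -[X in measurable X]setTI; exact: measurable_tnth.
  apply/seteqP; split => t /= H i.
    by move=> _; rewrite /= in_itv/=; exact: H.
  by have := H i I; rewrite /= in_itv.
rewrite /= /lebesgue_cons /pushforward E product_measure1E//.
have L : lebesgue_measure (`[- r, r]%classic : set R) = (r *+ 2)%:E.
  by rewrite lebesgue_measure_itv/= lte_fin gtrN// -EFinB opprK -mulr2n.
by rewrite IH [X in (X * _)%E]L -EFinM exprS.
Qed.

Lemma lebesgue_tuple_eball_gt0 m : (0 < lebesgue_tuple m (@eball m))%E.
Proof.
pose r : R := (m.+1%:R)^-1.
have r0 : 0 < r by rewrite invr_gt0 ltr0n.
have r1 : r <= 1 by rewrite invf_le1 ?ltr0n// ler1n.
have [mc Ec] := lebesgue_tuple_cube m r0.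
apply: (@lt_le_trans _ _ (lebesgue_tuple m (@cube r m))).
  by rewrite Ec lte_fin exprn_gt0// mulrn_wgt0.
apply: le_measure; rewrite ?inE//; first exact: measurable_eball.
move=> t H; rewrite /eball /= /enorm -[leRHS]sqrtr1 ler_wsqrtr//.
apply: (@le_trans _ _ (\sum_(i < m) r)).
  apply: ler_sum => i _.
  have ti : `|tnth t i| <= r by rewrite ler_norml H.
  rewrite -real_normK ?num_real// expr2.
  rewrite (le_trans (ler_pM _ _ ti ti))//.
  by rewrite ler_piMl// ltW.
rewrite sumr_const card_ord -mulr_natl ler_pdivrMr ?ltr0n// mul1r ler_nat.
exact: leqnSn.
Qed.

Lemma lebesgue_tuple_eball_lty m : (lebesgue_tuple m (@eball m) < +oo)%E.
Proof.
have [mc Ec] := lebesgue_tuple_cube m (@ltr01 R).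
apply: (@le_lt_trans _ _ (lebesgue_tuple m (@cube 1 m))).
  apply: le_measure; rewrite ?inE//; first exact: measurable_eball.
  move=> t H i; rewrite -ler_norml -sqrtr_sqr (le_trans _ H)// ler_wsqrtr//.
  by rewrite (bigD1 i)//= lerDl sumr_ge0// => j _; exact: sqr_ge0.
by rewrite Ec ltry.
Qed.

Section surface_measure_probability.
Variable m : nat.
Local Notation lambda := (lebesgue_tuple m).

Let ball_inv_ge0 : 0 <= (fine (lambda (@eball m)))^-1.
Proof. by rewrite invr_ge0 fine_ge0. Qed.

Let cone_measure : {measure set (m.-tuple RR) -> \bar R} :=
  mscale (NngNum ball_inv_ge0)
    (measure_function_pushforward__canonical__measure_function_Measure
       (mrestr lambda (@measurable_eball m)) (@measurable_radial m)).

Let surface_measureE : @surface_measure m = cone_measure.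
Proof.
apply/funext => E; rewrite /surface_measure /cone_measure /= /mscale /=.
by rewrite /pushforward /mrestr muleC setIC.
Qed.

Let surface_measure0 : @surface_measure m set0 = 0%E.
Proof. by rewrite surface_measureE measure0. Qed.

Let surface_measure_ge0 E : (0 <= @surface_measure m E)%E.
Proof. by rewrite surface_measureE measure_ge0. Qed.

Let surface_measure_sigma_additive : semi_sigma_additive (@surface_measure m).
Proof. by rewrite surface_measureE; exact: measure_semi_sigma_additive. Qed.

HB.instance Definition _ := isMeasure.Build _ _ _ (@surface_measure m)
  surface_measure0 surface_measure_ge0 surface_measure_sigma_additive.

Let surface_measureT : @surface_measure m setT = 1%E.
Proof.
have b0 := lebesgue_tuple_eball_gt0 m; have boo := lebesgue_tuple_eball_lty m.
have bfin : lambda (@eball m) \is a fin_num by rewrite ge0_fin_numE.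
rewrite /surface_measure preimage_setT setIT -[X in (X * _)%E]fineK//.
by rewrite -EFinM mulfV// gt_eqF// fine_gt0// b0.
Qed.

HB.instance Definition _ := Measure_isProbability.Build _ _ _
  (@surface_measure m) surface_measureT.

End surface_measure_probability.

End surface_measure.

Section numerical_range.
Context {R : realType}.
Local Notation C := R[i].
Local Notation RR := (measurableTypeR R).

(* <x, y> = y^* x *)
Definition cinner n (x y : 'cV[C]_n) : C := \sum_(i < n) x i 0 * (y i 0)^*.

Definition csphere n : set 'cV[C]_n := [set x | cinner x x = 1].

(* C^o is C with its norm topology *)
Definition numerical_range n (A : 'M[C]_n) : set C^o :=
  [set cinner (A *m x) x | x in @csphere n].

(* the isometry (a, b) |-> a + ib of R^n x R^n with C^n, see cinner_cvec *)
Definition cvec n (t : (n + n).-tuple RR) : 'cV[C]_n :=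
  \col_j (tnth t (lshift n j) +i* tnth t (rshift n j)).

Lemma cinner_cvec n (t : (n + n).-tuple RR) :
  cinner (cvec t) (cvec t) = (enorm t ^+ 2)%:C.
Proof.
rewrite /enorm sqr_sqrtr ?sumr_ge0// => [|i _]; last exact: sqr_ge0.
rewrite big_split_ord /= -big_split /= rmorph_sum; apply: eq_bigr => j _.
rewrite mxE; apply/eqP; rewrite eq_complex.
by apply/andP; split; apply/eqP => /=; ring.
Qed.

Definition borelC := g_sigma_algebraType (@open C^o).

Definition numerical_measure n (A : 'M[C]_n) : set borelC -> \bar R :=
  pushforward (@surface_measure R (n + n))
    (fun t => cinner (A *m cvec t) (cvec t) : borelC).

Section measurable.
Context d (T : measurableType d).
Implicit Types f g : T -> C.

Let mC f := measurable_fun setT (fun t => complex.Re (f t)) /\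
            measurable_fun setT (fun t => complex.Im (f t)).

Let mC_cst c : mC (fun=> c).
Proof. by split; exact: measurable_cst. Qed.

Let mCD f g : mC f -> mC g -> mC (fun t => f t + g t).
Proof.
move=> [f1 f2] [g1 g2]; split.
  rewrite (_ : (fun _ => _) = (fun t => complex.Re (f t) + complex.Re (g t))).
    exact: measurable_funD.
  by apply/funext => t; case: (f t) (g t) => ? ? [].
rewrite (_ : (fun _ => _) = (fun t => complex.Im (f t) + complex.Im (g t))).
  exact: measurable_funD.
by apply/funext => t; case: (f t) (g t) => ? ? [].
Qed.

Let mCM f g : mC f -> mC g -> mC (fun t => f t * g t).
Proof.
move=> [f1 f2] [g1 g2]; split.
  rewrite (_ : (fun _ => _) =
    (fun t => complex.Re (f t) * complex.Re (g t) -
              complex.Im (f t) * complex.Im (g t))).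
    by apply: measurable_funB; exact: measurable_funM.
  by apply/funext => t; case: (f t) (g t) => ? ? [].
rewrite (_ : (fun _ => _) =
  (fun t => complex.Re (f t) * complex.Im (g t) +
            complex.Im (f t) * complex.Re (g t))).
  by apply: measurable_funD; exact: measurable_funM.
by apply/funext => t; case: (f t) (g t) => ? ? [].
Qed.

Let mC_conj f : mC f -> mC (fun t => (f t)^*).
Proof.
move=> [f1 f2]; split.
  by rewrite (_ : (fun _ => _) = (fun t => complex.Re (f t)))//;
    apply/funext => t; case: (f t).
rewrite (_ : (fun _ => _) = (fun t => - complex.Im (f t))).
  exact: measurable_funN.
by apply/funext => t; case: (f t).
Qed.

Let mC_sum n (h : 'I_n -> T -> C) : (forall i, mC (h i)) ->
  mC (fun t => \sum_(i < n) h i t).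
Proof.
move=> mh; elim: n h mh => [|n IH] h mh.
  by under eq_fun do rewrite big_ord0; exact: mC_cst.
by under eq_fun do rewrite big_ord_recl; apply: mCD; [|apply: IH].
Qed.

Let rat_near (x e : R) : 0 < e -> exists q : rat, `|x - ratr q| < e.
Proof.
move=> e0; have /rat_in_itvoo[q] : x - e < x + e by rewrite ltrD2l gtrN.
by rewrite in_itv/= => H; exists q; rewrite ltr_distlC.
Qed.

Let norm_lt (a b e : R) : `|a| < e / 2 -> `|b| < e / 2 -> `|a +i* b| < e%:C.
Proof.
move=> ae be; have e0 : 0 < e.
  by move: (le_lt_trans (normr_ge0 a) ae); rewrite pmulr_lgt0// invr_gt0.
rewrite normc_def ltcR.
apply: (@le_lt_trans _ _ (`|a| + `|b|)); last by rewrite (splitr e) ltrD.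
have ab0 : 0 <= `|a| + `|b| by exact: addr_ge0.
rewrite -[leRHS]ger0_norm// -sqrtr_sqr ler_wsqrtr//.
rewrite sqrrD !real_normK ?num_real//.
by rewrite lerD2r lerDl mulrn_wge0// mulr_ge0.
Qed.

Lemma measurable_borelC (f : T -> C) :
  measurable_fun setT (fun t => complex.Re (f t)) ->
  measurable_fun setT (fun t => complex.Im (f t)) ->
  measurable_fun setT (f : T -> borelC).
Proof.
move=> mRe mIm.
apply: (@measurability _ _ _ borelC setT f (@open C^o) erefl) => _ [U oU <-].
rewrite setTI.
pose box (k : rat * rat * rat) : set C :=
  [set z | `|complex.Re z - ratr k.1.1| < ratr k.2 /\
           `|complex.Im z - ratr k.1.2| < ratr k.2].
pose F k := [set t | box k `<=` U /\ box k (f t)].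
have -> : f @^-1` U = \bigcup_k F k.
  apply/seteqP; split => [t Ut|t [k _ [+]]]; last exact.
  have /nbhs_ballP[/= e e0 eU] := open_nbhs_nbhs (conj oU Ut).
  have [Ime Ree] : complex.Im e = 0 /\ 0 < complex.Re e.
    by move: e0; rewrite ltcE/= => /andP[/eqP].
  have /rat_in_itvoo[r] : 0 < complex.Re e / 4 by rewrite divr_gt0.
  rewrite in_itv/= => /andP[r0 re].
  have [p hp] := rat_near (complex.Re (f t)) r0.
  have [q hq] := rat_near (complex.Im (f t)) r0.
  exists (p, q, r) => //; split => // z [/= zp zq]; apply: eU.
  rewrite -ball_normE /= (_ : e = (complex.Re e)%:C); last first.
    by apply/eqP; rewrite eq_complex /= Ime !eqxx.
  have near (x y s : R) : `|x - s| < ratr r -> `|y - s| < ratr r ->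
      `|x - y| < complex.Re e / 2.
    by move: re; rewrite !ltr_norml => re /andP[? ?] /andP[? ?]; lra.
  have := norm_lt (near _ _ _ hp zp) (near _ _ _ hq zq).
  by congr (`|_| < _); case: (f t) z {zp zq} => ? ? [].
apply: countable_bigcupT_measurable => // k.
have [kU|kU] := pselect (box k `<=` U); last first.
  by rewrite (_ : F k = set0)//; apply/seteqP; split => // t [].
rewrite (_ : F k =
  (fun t => complex.Re (f t)) @^-1` ball (ratr k.1.1 : R) (ratr k.2) `&`
  (fun t => complex.Im (f t)) @^-1` ball (ratr k.1.2 : R) (ratr k.2)).
  by apply: measurableI; rewrite -[X in measurable X]setTI;
    [apply: mRe|apply: mIm] => //; exact: measurable_ball.
apply/seteqP; split => t; rewrite /F /box -!ball_normE /=.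
  by move=> [_]; rewrite distrC (distrC _ (ratr k.1.2)).
by rewrite distrC (distrC (ratr k.1.2)).
Qed.

Lemma measurable_cinner_cvec n (A : 'M[C]_n) (w : T -> (n + n).-tuple RR) :
  measurable_fun setT w ->
  measurable_fun setT
    (fun t => cinner (A *m cvec (w t)) (cvec (w t)) : borelC).
Proof.
move=> mw; pose h t := cinner (A *m cvec (w t)) (cvec (w t)).
have mcvec j : mC (fun t => cvec (w t) j 0).
  split; under eq_fun do rewrite mxE /=.
    exact: (measurableT_comp (measurable_tnth _) mw).
  exact: (measurableT_comp (measurable_tnth _) mw).
have [mRe mIm] : mC h.
  apply: mC_sum => i; apply: mCM; last exact/mC_conj/mcvec.
  under [X in mC X]eq_fun do rewrite mxE.
  by apply: mC_sum => j; apply: mCM; [exact: mC_cst|exact: mcvec].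
exact: (measurable_borelC mRe mIm).
Qed.

End measurable.

Section numerical_measure_probability.
Variables (n : nat) (A : 'M[C]_n).

Let mf := @measurable_cinner_cvec _ _ n A id (@measurable_id _ _ setT).

Let mu : {measure set borelC -> \bar R} :=
  measure_function_pushforward__canonical__measure_function_Measure
    (@surface_measure R (n + n)) mf.

Let numerical_measure0 : numerical_measure A set0 = 0%E.
Proof. exact: (measure0 mu). Qed.

Let numerical_measure_ge0 S : (0 <= numerical_measure A S)%E.
Proof. exact: (measure_ge0 mu). Qed.

Let numerical_measure_sigma_additive :
  semi_sigma_additive (numerical_measure A).
Proof. exact: (@measure_semi_sigma_additive _ _ _ mu). Qed.

HB.instance Definition _ := isMeasure.Build _ _ _ (numerical_measure A)
  numerical_measure0 numerical_measure_ge0 numerical_measure_sigma_additive.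

Let numerical_measureT : numerical_measure A setT = 1%E.
Proof.
by rewrite /numerical_measure /pushforward preimage_setT probability_setT.
Qed.

HB.instance Definition _ := Measure_isProbability.Build _ _ _
  (numerical_measure A) numerical_measureT.

End numerical_measure_probability.

End numerical_range.

(* Main.v *)
(* Let q(x) = <(A - z0)x, x>.  Since z0 is interior to W(A), q attains small
   positive, negative and purely imaginary values of both signs, and this forces
   vectors y, z with q(y) > 0 > q(z) whose q-cross term is not Hermitian
   (exists_hyperbolic).  For t near y the equation q(t + c z) = 0 in the complex
   unknown c reduces to a real quadratic on a real line, so it has a root c(t)
   given by an explicit formula, continuous in t.  Rounding c(t) to a grid of
   mesh of order e, O(e^-2) translates of the cone over {|<Ax,x> - z0| <= e}
   cover a fixed small cube; Lebesgue measure being translation invariant, the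
   cone has volume at least a constant times e^2. *)
Require Import Defs.
From mathcomp Require Import all_boot all_order all_algebra complex.
From mathcomp Require Import all_classical all_reals all_analysis.
From mathcomp Require Import measurable_realfun ring lra.
Import Order.TTheory GRing.Theory Num.Theory numFieldNormedType.Exports.
Local Open Scope classical_set_scope.
Local Open Scope ring_scope.
Set Implicit Arguments.
Unset Strict Implicit.
Unset Printing Implicit Defensive.

(** * Sesquilinear forms *)

Section sesquilinear.
Variables (C : numClosedFieldType) (V : lmodType C).
Implicit Types (B : V -> V -> C) (x y w : V).

Definition sesquilinear B :=
  (forall a x y w, B (a *: x + y) w = a * B x w + B y w) /\
  (forall a x y w, B w (a *: x + y) = a^* * B w x + B w y).

(** Twice the skew-Hermitian part of a sesquilinear [B], and again a sesquilinear form. It vanishes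
    identically exactly when [B] is Hermitian. *)
Definition skew_form B x w := B x w - (B w x)^*.

Lemma sesquilinearN B : sesquilinear B -> sesquilinear (fun x w => - B x w).
Proof. by move=> [Bl Br]; split=> a x y w; rewrite (Bl, Br); ring. Qed.

Lemma exists_phase (d : C) : exists2 p : C, p * p^* = 1 & p * d \is Num.real.
Proof.
have [->|d0] := eqVneq d 0; first exists 1; rewrite ?mulr0 ?rpred0//.
  by rewrite conjC1 mulr1.
exists (d^* / `|d|).
  have nr : `|d|^* = `|d| by apply: conj_Creal; exact: normr_real.
  rewrite rmorphM/= conjCK fmorphV/= nr mulrACA [d^* * d]mulrC.
  rewrite -normCK -invfM -expr2 mulfV// expf_neq0//.
  by rewrite normr_eq0.
rewrite mulrAC [_ * d]mulrC -normCK expr2 mulfK ?normr_eq0//.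
Qed.

Lemma quadD B : sesquilinear B -> forall a x w,
  B (a *: x + w) (a *: x + w) =
  a * a^* * B x x + B w w + (a * B x w + a^* * B w x).
Proof. by move=> [Bl Br] a x w; rewrite Bl !Br; ring. Qed.

Lemma skew_formD B : sesquilinear B -> forall a x y w,
  skew_form B (a *: x + y) w = a * skew_form B x w + skew_form B y w /\
  skew_form B w (a *: x + y) = a^* * skew_form B w x + skew_form B w y.
Proof.
move=> [Bl Br] a x y w; rewrite /skew_form Bl Br !rmorphD !rmorphM /= !conjCK.
by split; ring.
Qed.

Lemma sesquilinear0 B w : sesquilinear B -> B 0 w = 0 /\ B w 0 = 0.
Proof.
move=> [Bl Br]; have idem (c : C) : c = c + c -> c = 0.
  by move/eqP; rewrite -subr_eq0 opprD addrA subrr sub0r oppr_eq0 => /eqP.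
split; apply: idem; first by have := Bl 1 0 0 w; rewrite scale1r addr0 mul1r.
by have := Br 1 0 0 w; rewrite scale1r addr0 conjC1 mul1r.
Qed.

Lemma quadZ B a x : sesquilinear B -> B (a *: x) (a *: x) = a * a^* * B x x.
Proof.
move=> sB; have [Bl Br] := sB.
have [B0 _] := sesquilinear0 (a *: x) sB; have [_ B0'] := sesquilinear0 x sB.
rewrite -[a *: x in LHS]addr0 Bl addr0 B0 addr0.
by rewrite -[a *: x]addr0 Br B0' addr0 mulrA.
Qed.

Lemma skew_form0 B w : sesquilinear B -> skew_form B w 0 = 0.
Proof.
by move=> /(sesquilinear0 w)[B0l B0r]; rewrite /skew_form B0l B0r conjC0 subrr.
Qed.

(** The sum differs from [a * skew_form B x w] by a number plus its conjugate, which is real. *)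
Lemma cross_real B (a : C) x w : a * skew_form B x w \is Num.real ->
  a * B x w + a^* * B w x \is Num.real.
Proof.
move=> aD.
have -> : a * B x w + a^* * B w x =
    a * skew_form B x w + (a^* * B w x + (a^* * B w x)^*).
  by rewrite /skew_form rmorphM/= conjCK; ring.
apply: rpredD => //; apply/CrealP.
by rewrite rmorphD/= conjCK addrC.
Qed.

(** With a phase [p] making the cross term real and [a = r * p], the value is a real quadratic in
    [r] with leading coefficient [B x x > 0], hence positive for large [r]. *)
Lemma quad_gt0 B x w : sesquilinear B -> 0 < B x x -> B w w \is Num.real ->
  exists a, 0 < B (a *: x + w) (a *: x + w).
Proof.
move=> sB x0 wr; have [p pp pD] := exists_phase (skew_form B x w).
set s := p * B x w + p^* * B w x; have sr : s \is Num.real by exact: cross_real.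
(* Chosen so that [r * B x x] equals [|s| + |B w w| + B x x]; substituting this once in
   [r ^+ 2 * B x x] compensates both the cross term [r * s] and [B w w]. *)
pose r := (`|s| + `|B w w|) / B x x + 1.
have r1 : 1 <= r by rewrite lerDr divr_ge0 ?addr_ge0 ?normr_ge0// ltW.
have rx : r * B x x = `|s| + `|B w w| + B x x.
  by rewrite mulrDl mul1r divfK// gt_eqF.
have rr : r^* = r by apply: conj_Creal; apply: ger0_real; apply: le_trans r1.
exists (r * p); rewrite (quadD sB).
have -> : r * p * (r * p)^* * B x x + B w w +
     (r * p * B x w + (r * p)^* * B w x)
   = r * (`|s| + s) + (r * `|B w w| + B w w) + r * B x x.
  rewrite rmorphM/= rr (_ : r * p * (r * p^*) = r * r); last first.
    by rewrite mulrACA pp mulr1.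
  rewrite -[r * r * _]mulrA {1}rx /s; ring.
have r0 : 0 < r by exact: lt_le_trans r1.
have N (k : C) : k \is Num.real -> 0 <= `|k| + k.
  move=> kr; rewrite -lerBlDl sub0r; have := lexx `|k|.
  by rewrite real_ler_norml => // /andP[].
rewrite ltr_wpDl ?mulr_gt0// addr_ge0//; first by rewrite mulr_ge0 ?N// ltW.
by rewrite (le_trans (N _ wr))// lerD2r ler_peMl.
Qed.


(* Otherwise skew_form vanishes on all pairs of vectors with real B x x (add a
   large multiple of y or z to each of them), in particular on the two vectors
   u + p v and u - p v with |p| = 1 chosen to make their values real, where it
   has imaginary part 4 r. *)
Lemma exists_hyperbolic B (r : C) y z u v : sesquilinear B -> 0 < r ->
  B y y = r -> B z z = - r -> B u u = 'i * r -> B v v = - ('i * r) ->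
  exists y z, [/\ 0 < B y y, B z z < 0 & skew_form B z y != 0].
Proof.
move=> sB r0 yr zr ur vr.
apply: contrapT => H.
have R0 y' z' : 0 < B y' y' -> B z' z' < 0 -> skew_form B z' y' = 0.
  move=> y0 z0; have [//|n] := eqVneq (skew_form B z' y') 0.
  by exfalso; apply: H; exists y', z'.
have R1 z' w : B z' z' < 0 -> B w w \is Num.real -> skew_form B z' w = 0.
  move=> z'0 wr; have y0 : 0 < B y y by rewrite yr.
  have [a a0] := quad_gt0 sB y0 wr.
  have := R0 _ _ a0 z'0.
  by rewrite (skew_formD sB _ _ _ _).2 (R0 _ _ y0 z'0) mulr0 add0r.
have R2 w' w : B w' w' \is Num.real -> B w w \is Num.real ->
    skew_form B w' w = 0.
  move=> w'r wr; have z0 : 0 < - B z z by rewrite zr opprK.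
  have [|a a0] := quad_gt0 (sesquilinearN sB) z0 (w := w').
    by rewrite rpredN.
  rewrite oppr_gt0 in a0; rewrite oppr_gt0 in z0.
  have := R1 _ _ a0 wr.
  by rewrite (skew_formD sB _ _ _ _).1 (R1 _ _ z0 wr) mulr0 add0r.
have [p pp pD] := exists_phase (skew_form B v u).
have wr a : a * a^* = 1 -> a * skew_form B v u \is Num.real ->
    B (a *: v + u) (a *: v + u) \is Num.real.
  move=> aa aD; rewrite (quadD sB) aa mul1r ur vr addNr add0r.
  exact: cross_real.
have wr' : B (- p *: v + u) (- p *: v + u) \is Num.real.
  by apply: wr; rewrite ?rmorphN/= ?mulrNN// mulNr rpredN.
have := R2 _ _ (wr _ pp pD) wr'.
rewrite (skew_formD sB _ _ _ _).1 !(skew_formD sB _ _ _ _).2 !rmorphN/=.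
have -> : skew_form B v v = - ('i * r) *+ 2.
  rewrite /skew_form vr rmorphN rmorphM/= conjCi.
  rewrite [r^*]conj_Creal ?ger0_real ?ltW//; ring.
have -> : skew_form B u u = 'i * r *+ 2.
  rewrite /skew_form ur rmorphM/= conjCi.
  rewrite [r^*]conj_Creal ?ger0_real ?ltW//; ring.
have -> : skew_form B u v = - (skew_form B v u)^*.
  by rewrite /skew_form rmorphB/= conjCK opprB.
have ppr : p^* * (skew_form B v u)^* = p * skew_form B v u.
  by rewrite -rmorphM/= conj_Creal.
move: pp ppr; set d := skew_form B v u; set e := d^*; set q := p^* => pp ppr E.
have : 2 * (p * d) + 4 * ('i * r) = 0 by rewrite -[RHS]E; ring: pp ppr.
have rr : r^* = r by rewrite conj_Creal// gtr0_real.
have pd : (p * d)^* = p * d by exact: conj_Creal.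
(* [p * d] is real and ['i * r] purely imaginary, so subtracting from [K] its conjugate leaves
   ['i * r *+ 8 = 0], against [0 < r]. *)
move=> K; have := congr1 Num.conj K.
rewrite rmorphD !rmorphM/= !rmorph_nat -rmorphM/= pd conjCi rr rmorph0 => K'.
have : 'i * r *+ 8 = 0 by rewrite -[RHS](subrr 0) -{1}K -K'; ring.
by apply/eqP; rewrite mulrn_eq0/= mulf_neq0 ?neq0Ci// lt0r_neq0.
Qed.
End sesquilinear.

(** * An explicit continuous root of a quadratic equation in z and its conjugate *)

Section fiber.
Variable C : numClosedFieldType.
Implicit Types a b c r : C.

(* fiber_root solves a + z b + z^* c = r |z|^2.  With d = b - c^*, the
   anti-Hermitian part of the equation says that z d has imaginary part -Im a,
   so z d = t - i Im a with t real; the Hermitian part is then a quadratic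
   equation in t, with leading coefficient -fiber_lead and reduced discriminant
   fiber_disc. *)
Definition hermitian_part c := (c + c^*) / 2.
Definition skew_part c := (c - c^*) / 2.

Definition fiber_slope b c := (b + c^*) / (b - c^*).
Definition fiber_lead b c r := r / ((b - c^*) * (b - c^*)^*).
Definition fiber_disc a b c r :=
  (hermitian_part (fiber_slope b c) / 2) ^+ 2 + fiber_lead b c r *
    (hermitian_part a - skew_part a * skew_part (fiber_slope b c) +
     fiber_lead b c r * skew_part a ^+ 2).
Definition fiber_root a b c r :=
  ((hermitian_part (fiber_slope b c) / 2 + sqrtC (fiber_disc a b c r)) /
     fiber_lead b c r - skew_part a) / (b - c^*).

Lemma hermitian_part_conj a : (hermitian_part a)^* = hermitian_part a.
Proof.
by rewrite /hermitian_part rmorphM/= fmorphV/= rmorph_nat rmorphD/= conjCK addrC.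
Qed.

Lemma skew_part_conj a : (skew_part a)^* = - skew_part a.
Proof.
rewrite /skew_part rmorphM/= fmorphV/= rmorph_nat rmorphB/= conjCK; ring.
Qed.

Lemma fiber_lead_conj b c r : r \is Num.real ->
  (fiber_lead b c r)^* = fiber_lead b c r.
Proof.
move=> rr; rewrite /fiber_lead rmorphM/= fmorphV/= rmorphM/= conjCK conj_Creal//.
by congr (_ / _); exact: mulrC.
Qed.

Lemma fiber_disc_real a b c r : r \is Num.real ->
  fiber_disc a b c r \is Num.real.
Proof.
move=> rr; have skewM x y : skew_part x * skew_part y \is Num.real.
  by apply/CrealP; rewrite rmorphM/= !skew_part_conj mulrNN.
have hr x : hermitian_part x \is Num.real by apply/CrealP/hermitian_part_conj.
have kr : fiber_lead b c r \is Num.real by apply/CrealP/fiber_lead_conj.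
apply: rpredD; first by apply/rpredX/rpred_div; [exact: hr|exact: realn].
apply: (rpredM kr); apply: rpredD; last exact: (rpredM kr (skewM _ _)).
by apply: rpredB; [exact: hr|exact: skewM].
Qed.

Lemma fiber_rootP a b c r : b - c^* != 0 -> 0 < r -> 0 <= fiber_disc a b c r ->
  let z := fiber_root a b c r in a + z * b + z^* * c - r * (z * z^*) = 0.
Proof.
move=> d0 r0 D0.
have rr : r \is Num.real by exact: gtr0_real.
set d := b - c^*; have dJ0 : d^* != 0 by rewrite conjC_eq0.
set k := fiber_lead b c r.
have k0 : k != 0.
  apply: mulf_neq0; first by rewrite gt_eqF.
  by rewrite invr_eq0 -/d mulf_neq0.
set s := sqrtC (fiber_disc a b c r).
have s2 : s ^+ 2 = fiber_disc a b c r by exact: sqrtCK.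
have sJ : s^* = s by rewrite conj_Creal// ger0_real// sqrtC_ge0.
set l := fiber_slope b c.
set h := hermitian_part l / 2.
have hJ : h^* = h.
  by rewrite /h rmorphM/= fmorphV/= rmorph_nat hermitian_part_conj.
set t := (h + s) / k.
have tJ : t^* = t.
  by rewrite /t rmorphM/= fmorphV/= fiber_lead_conj// rmorphD/= hJ sJ.
move=> z.
have zd : z * d = t - skew_part a by rewrite /z /fiber_root mulfVK.
have zJd : z^* * d^* = t + skew_part a.
  by rewrite -rmorphM/= zd rmorphB/= tJ skew_part_conj opprK.
(* Since [b + c^* = l * d] and [b - c^* = d], all of [b], [c] and [r] can be written through [l],
   [k] and [d]; the equation then involves [z] only through [z * d]. *)
have bE : b = (l * d + d) / 2 by rewrite /l /fiber_slope -/d divfK// /d; field.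
have cE : c = (l^* * d^* - d^*) / 2.
  rewrite -rmorphM/= /l /fiber_slope -/d divfK// /d.
  by rewrite !(rmorphD, rmorphN)/= !conjCK; field.
have rE : r = k * (d * d^*) by rewrite /k /fiber_lead divfK// mulf_neq0.
(* The real quadratic satisfied by [t]: multiplied by [k] and with the square completed, it says
   that [k * t - h] is the square root [s] of the discriminant. *)
have tE : k * t ^+ 2 = 2 * h * t +
    (hermitian_part a - skew_part a * skew_part l +
     k * skew_part a ^+ 2).
  have kt : k * t = h + s by rewrite /t mulrC divfK.
  apply: (mulfI k0).
  rewrite (_ : k * (k * t ^+ 2) = (k * t) ^+ 2); last by ring.
  rewrite mulrDr (_ : k * (2 * h * t) = 2 * h * (k * t)); last by ring.
  rewrite kt sqrrD s2 /fiber_disc -/k -/l -/h; ring.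
have aE : a = hermitian_part a + skew_part a.
  by rewrite /hermitian_part /skew_part; field.
rewrite rE.
have -> : k * (d * d^*) * (z * z^*) = k * ((z * d) * (z^* * d^*)) by ring.
have -> : z * b = (l * (z * d) + z * d) / 2 by rewrite bE; field.
have -> : z^* * c = (l^* * (z^* * d^*) - z^* * d^*) / 2 by rewrite cE; field.
rewrite zd zJd (_ : k * ((t - skew_part a) * (t + skew_part a)) =
  k * t ^+ 2 - k * skew_part a ^+ 2); last by ring.
by rewrite tE {1}aE /h /skew_part /hermitian_part; field.
Qed.


Section limits.
Variables (T : Type) (F : set_system T).
Context {FF : Filter F}.

Lemma cvg_conjC (f : T -> C) a : f @ F --> a -> (fun t => (f t)^*) @ F --> a^*.
Proof.
move=> /cvgrPdist_lt fa; apply/cvgrPdist_lt => e e0.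
by apply: filterS (fa e e0) => t; rewrite -rmorphB norm_conjC.
Qed.

(** A real number closer to [a] than [a] itself is positive. For such values the difference of the
    square roots, times [sqrtC a], is at most the difference of the numbers. *)
Lemma cvg_sqrtC (f : T -> C) a : (forall t, f t \is Num.real) -> 0 < a ->
  f @ F --> a ->
  (\forall t \near F, 0 <= f t) /\ (fun t => sqrtC (f t)) @ F --> sqrtC a.
Proof.
move=> fr a0 /cvgrPdist_lt fa.
have ar : a \is Num.real by exact: gtr0_real.
have f0 : \forall t \near F, 0 <= f t.
  apply: filterS (fa a a0) => t.
  rewrite real_ltr_norml ?rpredB// => /andP[_].
  by rewrite gtrBl => /ltW.
split => //; apply/cvgrPdist_lt => e e0.
have sa0 : 0 < sqrtC a by rewrite sqrtC_gt0.
near=> t.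
have ft0 : 0 <= f t by near: t.
rewrite -(ltr_pM2r sa0).
have fe : `|a - f t| < e * sqrtC a by near: t; apply: fa; rewrite mulr_gt0.
apply: le_lt_trans fe.
rewrite -[a in leRHS]sqrtCK -[f t in leRHS]sqrtCK subr_sqr normrM ler_wpM2l//.
by rewrite ger0_norm ?addr_ge0 ?sqrtC_ge0 ?(ltW a0)// lerDl sqrtC_ge0.
Unshelve. all: by end_near. Qed.

(** Positivity of the limit [a] makes the limiting discriminant strictly positive. It therefore
    stays nonnegative nearby, and every operation in the root formula is continuous at the limit. *)
Lemma cvg_fiber_root (fa fb fc : T -> C) a b c r :
  0 < r -> 0 < a -> b - c^* != 0 ->
  fa @ F --> a -> fb @ F --> b -> fc @ F --> c ->
  (\forall t \near F, let z := fiber_root (fa t) (fb t) (fc t) r in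
     fa t + z * fb t + z^* * fc t - r * (z * z^*) = 0) /\
  (fun t => fiber_root (fa t) (fb t) (fc t) r) @ F --> fiber_root a b c r.
Proof.
move=> r0 a0 d0 cva cvb cvc; have rr := gtr0_real r0.
have cherm (f : T -> C) x : f @ F --> x ->
    (fun t => hermitian_part (f t)) @ F --> hermitian_part x.
  by move=> fx; apply: cvgMl; apply: cvgD => //; exact: cvg_conjC.
have cskew (f : T -> C) x : f @ F --> x ->
    (fun t => skew_part (f t)) @ F --> skew_part x.
  by move=> fx; apply: cvgMl; apply: cvgB => //; exact: cvg_conjC.
have cd : (fun t => fb t - (fc t)^*) @ F --> b - c^*.
  by apply: cvgB => //; exact: cvg_conjC.
have cdV : (fun t => (fb t - (fc t)^*)^-1) @ F --> (b - c^*)^-1 by exact: cvgV.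
have cslope : (fun t => fiber_slope (fb t) (fc t)) @ F --> fiber_slope b c.
  by apply: cvgM => //; apply: cvgD => //; exact: cvg_conjC.
have dd0 : (b - c^*) * (b - c^*)^* != 0 by rewrite mulf_neq0// conjC_eq0.
have clead : (fun t => fiber_lead (fb t) (fc t) r) @ F --> fiber_lead b c r.
  by apply: cvgMr; apply: cvgV => //; apply: cvgM => //; exact: cvg_conjC.
have lead0 : 0 < fiber_lead b c r.
  by rewrite divr_gt0// lt0r dd0 mul_conjC_ge0.
have clead1 : (fun t => (fiber_lead (fb t) (fc t) r)^-1) @ F -->
    (fiber_lead b c r)^-1.
  by apply: cvgV => //; rewrite gt_eqF.
have ch : (fun t => hermitian_part (fiber_slope (fb t) (fc t)) / 2) @ F -->
    hermitian_part (fiber_slope b c) / 2.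
  by apply: cvgMl; exact: cherm.
have cdisc : (fun t => fiber_disc (fa t) (fb t) (fc t) r) @ F -->
    fiber_disc a b c r.
  have cs2 : (fun t => skew_part (fa t) ^+ 2) @ F --> skew_part a ^+ 2.
    by rewrite expr2; under eq_fun do rewrite expr2; apply: cvgM; exact: cskew.
  apply: cvgD; first by rewrite expr2; under eq_fun do rewrite expr2; apply: cvgM.
  apply: cvgM => //; apply: cvgD; last exact: cvgM.
  apply: cvgB; first exact: cherm.
  by apply: cvgM; exact: cskew.
(* [a] is real, so its skew part vanishes and the discriminant is the square of a real number plus
   [fiber_lead b c r * a]. *)
have disc0 : 0 < fiber_disc a b c r.
  have ar : a^* = a by rewrite conj_Creal ?gtr0_real.
  rewrite /fiber_disc.
  have -> : skew_part a = 0 by rewrite /skew_part ar subrr mul0r.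
  have -> : hermitian_part a = a by rewrite /hermitian_part ar; field.
  rewrite mul0r subr0 expr0n/= mulr0 addr0 ltr_wpDl ?(mulr_gt0 lead0 a0)//.
  rewrite real_exprn_even_ge0//.
  by apply/CrealP; rewrite rmorphM/= hermitian_part_conj fmorphV/= rmorph_nat.
have [disc_ge0 csqrt] := cvg_sqrtC
  (fun t => fiber_disc_real (fa t) (fb t) (fc t) rr) disc0 cdisc.
split; last first.
  apply: cvgM => //; apply: cvgB; last exact: cskew.
  by apply: cvgM => //; exact: cvgD.
near=> t; apply: fiber_rootP => //; near: t => //.
exact: (cvgr_neq0 _ cd d0).
Unshelve. all: by end_near. Qed.

End limits.
End fiber.

(** * The sesquilinear form of a matrix and its continuity *)

Section matrix_form.
Variables (C : numClosedFieldType) (n : nat) (A : 'M[C]_n).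

Definition mxform (x w : 'cV[C]_n) : C := \sum_i (A *m x) i 0 * (w i 0)^*.

Lemma mxform_sesquilinear : sesquilinear mxform.
Proof.
split=> a x y w; rewrite /mxform mulr_sumr -big_split/=; apply: eq_bigr => i _.
  by rewrite mulmxDr -scalemxAr !mxE; ring.
by rewrite !mxE rmorphD rmorphM/=; ring.
Qed.

Variables (T : Type) (F : set_system T).
Context {FF : Filter F}.

Lemma cvg_mxform (f g : T -> 'cV[C]_n) (x w : 'cV[C]_n) :
  (forall i, (fun t => f t i 0) @ F --> x i 0) ->
  (forall i, (fun t => g t i 0) @ F --> w i 0) ->
  (fun t => mxform (f t) (g t)) @ F --> mxform x w.
Proof.
move=> fx gw; apply: cvg_big => [|i _]; first exact: add_continuous.
apply: cvgM; last exact: cvg_conjC.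
rewrite mxE; under eq_fun do rewrite mxE.
by apply: cvg_big => [|j _]; [exact: add_continuous|exact: cvgMr].
Qed.

End matrix_form.
Arguments cvg_mxform {C n} A {T F FF f g x w}.

Lemma mxform1 (C : numClosedFieldType) n (x : 'cV[C]_n) :
  mxform 1%:M x x = \sum_i `|x i 0| ^+ 2.
Proof. by apply: eq_bigr => i _; rewrite mul1mx -normCK. Qed.

Lemma mxform1_ge0 (C : numClosedFieldType) n (x : 'cV[C]_n) :
  0 <= mxform 1%:M x x.
Proof. by rewrite mxform1; apply: sumr_ge0 => i _; apply: exprn_ge0. Qed.

(** * Zeros of the form on complex lines in direction z, with uniform control around them *)

Section zeros.
Variables (C : numClosedFieldType) (n : nat) (A : 'M[C]_n) (y z : 'cV[C]_n).
Hypotheses (y0 : 0 < mxform A y y) (z0 : mxform A z z < 0).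
Hypothesis (s0 : skew_form (mxform A) z y != 0).
Variables (T : Type) (F : set_system T) (x : T -> 'cV[C]_n).
Context {FF : Filter F}.
Hypothesis near_xy : forall i e, 0 < e ->
  \forall t \near F, `|y i 0 - x t i 0| < e.

(** Expanding the form at [c *: z + x t] gives the equation of [fiber_rootP] in [c], with
    [r = - mxform A z z]; [f t] is its root. Around this zero the form is of order |h|, and the
    squared norm [mxform 1%:M X X] stays near that of the nonzero limit vector. *)
Lemma near_zeros : exists (f : T -> C) (c0 m M L d : C),
  [/\ 0 < m, 0 < L, 0 < d &
  \forall t \near F, `|c0 - f t| < 1 /\ forall h, `|h| < d ->
     let X := (f t + h) *: z + x t in
     m <= mxform 1%:M X X <= M /\ `|mxform A X X| <= L * `|h| ].
Proof.
have xy i : (fun t => x t i 0) @ F --> y i 0.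
  by apply/cvgrPdist_lt; exact: near_xy.
pose r := - mxform A z z; have r0 : 0 < r by rewrite oppr_gt0.
have cz i : (fun _ : T => z i 0) @ F --> z i 0 by exact: cvg_cst.
have [zeros cvf] := cvg_fiber_root r0 y0 s0 (cvg_mxform A xy xy)
  (cvg_mxform A cz xy) (cvg_mxform A xy cz).
set f := fun t => _ in cvf; set c0 := fiber_root _ _ _ _ in cvf.
pose X0 t := f t *: z + x t; pose x0 := c0 *: z + y.
have cX0 i : (fun t => X0 t i 0) @ F --> x0 i 0.
  rewrite !mxE; under eq_fun do rewrite !mxE.
  by apply: cvgD => //; exact: cvgMl.
have sA := mxform_sesquilinear A.
have qX0 : \forall t \near F, mxform A (X0 t) (X0 t) = 0.
  apply: filterS zeros => t /= E.
  by rewrite (quadD sA) -[RHS]E /r -/(f t); ring.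
have skz : skew_form (mxform A) z z = 0.
  apply/eqP; rewrite subr_eq0 eq_sym; apply/eqP.
  by rewrite conj_Creal// ltr0_real.
(* Otherwise [y] is a multiple of [z], and [skew_form] vanishes on [z, z] because [mxform A z z] is
   real; this contradicts [s0]. *)
have x0N0 : exists i, x0 i 0 != 0.
  apply: contrapT => H; move/eqP: s0; apply.
  have x00 : x0 = 0.
    apply/matrixP => i j; rewrite ord1 [RHS]mxE.
    have [//|ne] := eqVneq (x0 i 0) 0.
    by exfalso; apply: H; exists i.
  have := skew_form0 z sA; rewrite -x00.
  by rewrite (skew_formD sA _ _ _ _).2 skz mulr0 add0r.
pose N0 := mxform 1%:M x0 x0.
have N00 : 0 < N0.
  have [i xi] := x0N0; rewrite /N0 mxform1 (bigD1 i)//=.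
  rewrite ltr_wpDr ?exprn_gt0 ?normr_gt0//.
  by apply: sumr_ge0 => j _; exact: exprn_ge0.
(* The radius [d] must not depend on [t], so convergence is taken jointly in [t] and in [h] tending
   to 0. *)
pose X (p : T * C) := (f p.1 + p.2) *: z + x p.1.
have lift (g : T -> C) (l : C) : (g @ F --> l) ->
    (fun p : T * C => g p.1) @ filter_prod F (nbhs (0 : C)) --> l.
  by move=> gl; apply: (@cvg_comp _ _ _ fst g _ F) => //; exact: cvg_fst.
have cX i : (fun p => X p i 0) @ filter_prod F (nbhs (0 : C)) --> x0 i 0.
  rewrite !mxE; under eq_fun do rewrite !mxE.
  apply: cvgD; last exact: (lift (fun t => x t i 0)).
  apply: cvgMl; rewrite -[c0]addr0; apply: cvgD; last exact: cvg_snd.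
  exact: (lift f).
have FF2 : Filter (filter_prod F (nbhs (0 : C))) by exact: filter_prod_filter.
have cN : (fun p => mxform 1%:M (X p) (X p)) @
    filter_prod F (nbhs (0 : C)) --> N0.
  exact: cvg_mxform.
have N02 : 0 < N0 / 2 by rewrite divr_gt0.
move: (cN) => /cvgrPdist_lt/(_ _ N02)[[P Q] /= [FP NQ] PQ].
have : nbhs (0 : C) (Q `&` [set h | `|h| < 1]).
  apply: filterI => //.
  have := @cvgr_norm_lt _ C _ (nbhs (0 : C)) _ id 0 (@cvg_id _ _) 1.
  by rewrite normr0; apply.
move=> /nbhs_ballP[/= d d0 dQ].
pose b0 := mxform A z x0; pose e0 := mxform A x0 z.
(* The norm bounds come from being within [N0 / 2] of [N0]. In the last bound the two cross terms
   contribute [|b0| + 1] and [|e0| + 1], and [r] covers the quadratic term, as [|h| < 1]. *)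
exists f, c0, (N0 / 2), (N0 * 2), (`|b0| + 1 + (`|e0| + 1) + r), d; split => //.
  by rewrite ltr_pwDr// !addr_ge0.
have cb : (fun t => mxform A z (X0 t)) @ F --> b0 by exact: cvg_mxform.
have ce : (fun t => mxform A (X0 t) z) @ F --> e0 by exact: cvg_mxform.
near=> t; split; first by near: t; exact: cvgr_dist_lt.
move=> h hd; set Xt := (f t + h) *: z + x t; cbv zeta.
have [Qh h1] : (Q `&` [set h | `|h| < 1]) h.
  by apply: dQ; rewrite -ball_normE/= sub0r normrN.
have Pt : P t by near: t.
split.
  have Nr : mxform 1%:M Xt Xt \is Num.real.
    exact/ger0_real/mxform1_ge0.
  have Nr0 := gtr0_real N00.
  have hr : N0 / 2 \is Num.real by apply: ger0_real; rewrite divr_ge0// ltW.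
  have : `|N0 - mxform 1%:M Xt Xt| < N0 / 2 by exact: (PQ (t, h)).
  rewrite real_ltr_norml ?rpredB// => /andP[N1 N2].
  have half : N0 / 2 = N0 - N0 / 2 by field.
  apply/andP; split.
    by rewrite half lerBlDl -lerBlDr ltW.
  rewrite ltrBrDr addrC ltrBlDr in N1; apply/ltW/(lt_le_trans N1).
  by rewrite mulr_natr mulr2n lerD2l half gerBl ltW.
have -> : Xt = h *: z + X0 t by rewrite /Xt /X0 scalerDl -addrA addrCA.
rewrite (quadD sA).
have -> : mxform A (X0 t) (X0 t) = 0 by near: t.
have bt : `|mxform A z (X0 t)| <= `|b0| + 1.
  by near: t; apply: (cvgr_norm_le _ cb); rewrite ltrDl.
have et : `|mxform A (X0 t) z| <= `|e0| + 1.
  by near: t; apply: (cvgr_norm_le _ ce); rewrite ltrDl.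
rewrite addr0 (le_trans (ler_normD _ _))// addrC [leRHS]mulrDl; apply: lerD.
  rewrite mulrDl (le_trans (ler_normD _ _))// !normrM norm_conjC 
    ![_ * `|h|]mulrC.
  by apply: lerD; rewrite ler_wpM2l.
rewrite !normrM norm_conjC (ltr0_norm z0) -/r mulrC ler_wpM2l ?(ltW r0)//.
by rewrite ler_piMl// ltW.
Unshelve. all: by end_near. Qed.
End zeros.

(** * Translation invariance of Lebesgue measure *)

Section translation.
Context {R : realType}.
Local Notation RR := (measurableTypeR R).

(** The pushforward under translation agrees with Lebesgue measure on half-open intervals, which
    determine it. *)
Lemma lebesgue_measure_translate (a : R) (A : set RR) : measurable A ->
  lebesgue_measure ((fun x : RR => x + a : RR) @^-1` A) = lebesgue_measure A.
Proof.
move=> mA.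
have mf : measurable_fun setT (fun x : RR => x + a : RR).
  by apply: measurable_funD => //; exact: measurable_id.
pose mu : {measure set RR -> \bar R} :=
  measure_function_pushforward__canonical__measure_function_Measure
    (@lebesgue_measure R) mf.
rewrite -[LHS]/(mu A); apply/esym/lebesgue_measure_unique => // _ [[b c] _ <-].
rewrite -[RHS]/(lebesgue_measure ((fun x : RR => x + a : RR) @^-1` _)).
have -> : (fun x : RR => x + a : RR) @^-1` `]b, c]%classic =
          `]b - a, c - a]%classic.
  by apply/seteqP; split => x /=; rewrite !in_itv/= ltrBlDr lerBrDr.
rewrite !lebesgue_measure_itv/= !lte_fin ltrD2r.
by case: ifP => // _; rewrite -!EFinB; congr _%:E; ring.
Qed.

Definition translate m (w t : m.-tuple RR) : m.-tuple RR :=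
  [tuple tnth t i + tnth w i | i < m].

Lemma measurable_translate m (w : m.-tuple RR) :
  measurable_fun setT (translate w).
Proof.
apply/measurable_fun_tnthP => i.
rewrite (_ : _ \o _ = fun t => tnth t i + tnth w i); last first.
  by apply/funext => t /=; rewrite tnth_mktuple.
by apply: measurable_funD; [exact: measurable_tnth|exact: measurable_cst].
Qed.

(** By induction: through [cons_pair] a translation becomes a product of translations, and a product
    measure is determined by its values on rectangles. *)
Lemma lebesgue_tuple_translate m (w : m.-tuple RR) E : measurable E ->
  lebesgue_tuple m (translate w @^-1` E) = lebesgue_tuple m E.
Proof.
elim: m w E => [|m IH] w E mE.
  congr (lebesgue_tuple 0 _); apply/funext => t /=.
  by rewrite [translate w t]tuple0 [t]tuple0.
pose w' : m.-tuple RR := [tuple of behead w].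
pose S (p : RR * m.-tuple RR) : RR * m.-tuple RR :=
  (p.1 + thead w, translate w' p.2).
have mS : measurable_fun setT S.
  apply: measurable_fun_pair.
    by apply: measurable_funD; [exact: measurable_fst|exact: measurable_cst].
  by apply: measurableT_comp; [exact: measurable_translate|exact: measurable_snd].
have mcE : measurable (@cons_pair R m @^-1` E).
  by rewrite -[X in measurable X]setTI; exact: measurable_cons_pair.
rewrite /= /lebesgue_cons /pushforward.
have -> : @cons_pair R m @^-1` (translate w @^-1` E) =
    S @^-1` (@cons_pair R m @^-1` E).
  have cS p : translate w (cons_pair p) = cons_pair (S p).
    apply: eq_from_tnth => i; rewrite tnth_mktuple.
    case: (unliftP ord0 i) => [j|] ->; rewrite /cons_pair ?tnthS ?tnth0 //.
    rewrite tnth_mktuple tnth_behead; congr (_ + tnth w _); apply/val_inj. 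
    by rewrite /= inordK ?ltnS ?ltn_ord.
  by apply/funext => p /=; rewrite cS.
pose mu : {measure set (RR * m.-tuple RR) -> \bar R} :=
  measure_function_pushforward__canonical__measure_function_Measure
    (lebesgue_measure \x lebesgue_tuple m)%E mS.
rewrite -[LHS]/(mu _); apply/esym/product_measure_unique => // A B mA mB.
rewrite -[LHS]/((lebesgue_measure \x lebesgue_tuple m)%E (S @^-1` (A `*` B))).
have -> : S @^-1` (A `*` B) =
  ((fun x : RR => x + thead w : RR) @^-1` A) `*` (translate w' @^-1` B) by [].
rewrite product_measure1E; last 2 first.
  - rewrite -[X in measurable X]setTI; exact: measurable_funD.
  - by rewrite -[X in measurable X]setTI; exact: measurable_translate.
by congr (_ * _)%E; [exact: lebesgue_measure_translate|exact: IH].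
Qed.

(** Finite subadditivity over the preimages of [E], all of which have the measure of [E] by
    translation invariance. *)
Lemma lebesgue_tuple_le_cover m (s : seq (m.-tuple RR))
    (B E : set (m.-tuple RR)) :
  measurable B -> measurable E ->
  (forall t, B t -> exists2 w, w \in s & E (translate w t)) ->
  (lebesgue_tuple m B <= (size s)%:R%:E * lebesgue_tuple m E)%E.
Proof.
move=> mB mE cover.
pose U := \big[setU/set0]_(w <- s) (translate w @^-1` E).
have mpre w : measurable (translate w @^-1` E).
  by rewrite -[X in measurable X]setTI; exact: measurable_translate.
have mU : measurable U by apply: bigsetU_measurable => w _; exact: mpre.
apply: (@le_trans _ _ (lebesgue_tuple m U)).
  apply: le_measure; rewrite ?inE// => t /cover[w ws Ew].
  by rewrite /U (big_rem w)//=; left.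
rewrite {}/U in mU *; elim: s {cover} mU => [|w s IH] mU.
  by rewrite big_nil measure0 mul0e.
have mUs : measurable (\big[setU/set0]_(j <- s) (translate j @^-1` E)).
  by apply: bigsetU_measurable.
rewrite big_cons (le_trans (measureU2 _ _ _))//.
rewrite /= -[(size s).+1%:R]nat1r EFinD ge0_muleDl ?lee_fin// mul1e.
apply: leeD; last exact: IH.
by rewrite lebesgue_tuple_translate.
Qed.

Lemma lebesgue_tuple_cube_at m (c : m.-tuple RR) (r : R) : 0 < r ->
  measurable [set t : m.-tuple RR | forall i, `|tnth t i - tnth c i| <= r] /\
  lebesgue_tuple m [set t : m.-tuple RR | forall i, `|tnth t i - tnth c i| <= r]
    = ((r *+ 2) ^+ m)%:E.
Proof.
move=> r0; have [mc Ec] := lebesgue_tuple_cube m r0.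
have -> : [set t : m.-tuple RR | forall i, `|tnth t i - tnth c i| <= r] =
  translate [tuple - tnth c i | i < m] @^-1` (cube r (m:=m)).
  apply/seteqP; split => t /= H i; have := H i;
    by rewrite !tnth_mktuple ler_norml.
split; last by rewrite lebesgue_tuple_translate.
by rewrite -[X in measurable X]setTI; exact: measurable_translate.
Qed.
End translation.

Local Open Scope complex_scope.

(** * Complex vectors as real tuples *)

Section complex_vectors.
Context {R : realType}.
Local Notation C := R[i].
Local Notation RR := (measurableTypeR R).

Lemma normc_le (c : C) : `|c| <= (`|complex.Re c| + `|complex.Im c|)%:C.
Proof.
rewrite normc_def lecR -[leRHS]ger0_norm ?addr_ge0// -sqrtr_sqr ler_wsqrtr//.
rewrite sqrrD !real_normK ?num_real// lerD2r lerDl.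
by rewrite mulrn_wge0// mulr_ge0.
Qed.

Lemma Re_gt0E (c : C) : 0 < c -> exists2 r : R, 0 < r & c = r%:C.
Proof.
case: c => r i; rewrite ltcE/= => /andP[/eqP -> r0]; by exists r.
Qed.

Definition uncvec n (v : 'cV[C]_n) : (n + n).-tuple RR :=
  [tuple match fintype.split i with inl j => complex.Re (v j 0)
                          | inr j => complex.Im (v j 0) end | i < n + n].

Lemma uncvecK n : cancel (@uncvec n) (@cvec R n).
Proof.
move=> v; apply/matrixP => i j; rewrite ord1 !mxE !tnth_mktuple.
have -> : fintype.split (lshift n i) = inl i by exact: (unsplitK (inl i)).
have -> : fintype.split (rshift n i) = inr i by exact: (unsplitK (inr i)).
by case: (v i 0).
Qed.

Definition scale_tuple m (a : R) (t : m.-tuple RR) : m.-tuple RR :=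
  [tuple a * tnth t i | i < m].

Lemma cvec_translate n (w t : (n + n).-tuple RR) :
  cvec (translate w t) = cvec w + cvec t.
Proof.
apply/matrixP => i j; rewrite !mxE !tnth_mktuple; apply/eqP.
by rewrite eq_complex/= ![_ + tnth w _]addrC !eqxx.
Qed.

Lemma cvec_scale n (a : R) (t : (n + n).-tuple RR) :
  cvec (scale_tuple a t) = a%:C *: cvec t.
Proof.
apply/matrixP => i j; rewrite !mxE !tnth_mktuple; apply/eqP.
by rewrite eq_complex/= !mul0r subr0 addr0 !eqxx.
Qed.

Lemma enorm_scale m (a : R) (t : m.-tuple RR) : 0 <= a ->
  enorm (scale_tuple a t) = a * enorm t.
Proof.
move=> a0; rewrite /enorm; under eq_bigr do rewrite tnth_mktuple exprMn.
by rewrite -mulr_sumr sqrtrM ?sqr_ge0// sqrtr_sqr ger0_norm.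
Qed.

Lemma radialE m (t : m.-tuple RR) : radial t = scale_tuple (enorm t)^-1 t.
Proof. by []. Qed.

Lemma radial_scale m (a : R) (t : m.-tuple RR) : 0 < a ->
  radial (scale_tuple a t) = radial t.
Proof.
move=> a0; apply: eq_from_tnth => i.
rewrite !tnth_mktuple enorm_scale ?ltW// invfM mulrACA mulVf ?mul1r ?lt0r_neq0//.
Qed.

Lemma mxformE n (A : 'M[C]_n) x w : mxform A x w = cinner (A *m x) w.
Proof. by []. Qed.

Lemma mxform1_cvec n (t : (n + n).-tuple RR) :
  mxform 1%:M (cvec t) (cvec t) = (enorm t ^+ 2)%:C.
Proof. by rewrite mxformE mul1mx cinner_cvec. Qed.

Lemma mxform_shift n (A : 'M[C]_n) (c : C) (x : 'cV[C]_n) :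
  mxform (A - c%:M) x x = cinner (A *m x) x - c * cinner x x.
Proof.
rewrite mxformE /cinner mulr_sumr -sumrB; apply: eq_bigr => i _.
by rewrite mulmxBl mul_scalar_mx !mxE mulrBl mulrA.
Qed.

(** On a unit vector subtracting [c] amounts to replacing [A] by [A - c%:M], and the form is
    homogeneous of degree 2. The distance to [c] can thus be estimated before normalization. *)
Lemma cinner_radial n (A : 'M[C]_n) (c : C) (t : (n + n).-tuple RR) :
  enorm t != 0 ->
  cinner (A *m cvec (radial t)) (cvec (radial t)) - c =
  mxform (A - c%:M) (cvec t) (cvec t) / (enorm t ^+ 2)%:C.
Proof.
move=> t0; have := mxform_shift A c (cvec (radial t)).
rewrite cinner_cvec enorm_radial// expr1n mulr1 => <-.
rewrite radialE cvec_scale (quadZ _ _ (mxform_sesquilinear _)) mulrC.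
congr (_ * _); rewrite -[RHS]fmorphV/= -exprVn expr2 rmorphM/=.
by congr (_ * _); exact: conjc_real.
Qed.

(** The neighbourhood filter of [c] for the sup norm; what holds near [c] then holds on a whole
    cube, whose volume is known. *)
Definition cube_filter m (c : m.-tuple RR) : set_system (m.-tuple RR) :=
  filter_from [set r : R | 0 < r]
    (fun r => [set t | forall i, `|tnth t i - tnth c i| <= r]).

#[global] Instance cube_filter_filter m (c : m.-tuple RR) :
  Filter (cube_filter c).
Proof.
apply: filter_from_filter; first by exists 1; exact: ltr01.
move=> r s r0 s0; exists (Num.min r s); first by rewrite /= lt_min r0.
move=> t H; split => i; rewrite (le_trans (H i))// ge_min lexx ?orbT//.
Qed.

Lemma near_cvec n (c : (n + n).-tuple RR) i (e : C) : 0 < e ->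
  \forall t \near cube_filter c, `|cvec c i 0 - cvec t i 0| < e.
Proof.
move=> /Re_gt0E[{}e e0 ->].
exists (e / 4); first by rewrite /= divr_gt0.
move=> t H; rewrite /= !mxE; apply: (le_lt_trans (normc_le _)).
rewrite ltcR /=.
have h1 := H (lshift n i); have h2 := H (rshift n i).
rewrite distrC in h1; rewrite distrC in h2.
apply: (le_lt_trans (lerD h1 h2)); lra.
Qed.

End complex_vectors.

(** * The cone over a disc around an interior point *)

Section cone_volume.
Context {R : realType}.
Local Notation C := R[i].
Local Notation RR := (measurableTypeR R).

(** A disc of radius [e] around [z0] inside the numerical range lets the form of [A - z0%:M] take
    the values [e / 2] times 1, -1, i and -i, as [exists_hyperbolic] requires; [near_zeros] is then
    applied along the cubes around [y]. *)
Lemma interior_zeros n (A : 'M[C]_n) (z0 : C) : (numerical_range A)° z0 ->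
  exists (y : (n + n).-tuple RR) (z : 'cV[C]_n) (f : (n + n).-tuple RR -> C)
         (c0 : C) (r m M L d : R),
    [/\ [/\ 0 < r, 0 < m, 0 < M, 0 < L & 0 < d] &
    forall t, (forall i, `|tnth t i - tnth y i| <= r) ->
      `|c0 - f t| < 1 /\ forall h : C, `|h| < d%:C ->
        let X := translate (uncvec ((f t + h) *: z)) t in
        m <= enorm X ^+ 2 <= M /\
        `|mxform (A - z0%:M) (cvec X) (cvec X)| <= L%:C * `|h|].
Proof.
move=> /nbhs_ballP[/= e0 /Re_gt0E[e e_gt0 ->] eW].
have range (c : C) : `|c| < e%:C -> exists x, mxform (A - z0%:M) x x = c.
  move=> ce; have /eW[x xS xE] : ball (z0 : C^o) e%:C (z0 + c).
    by rewrite -ball_normE/= opprD addrA subrr sub0r normrN.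
  by exists x; rewrite mxform_shift xS mulr1 xE addrC addKr.
have e20 : 0 < (e / 2)%:C :> C by rewrite ltcR divr_gt0.
have rangeU (u : C) : `|u| = 1 ->
    exists x, mxform (A - z0%:M) x x = u * (e / 2)%:C.
  by move=> u1; apply: range; rewrite normrM u1 mul1r gtr0_norm// ltcR; lra.
have [x1 E1] := rangeU 1 (normr1 _).
have [x2 E2] := rangeU (- 1) (normrN1 _).
have [x3 E3] := rangeU 'i%R (normCi _).
have [|x4 E4] := rangeU (- 'i%R); first by rewrite normrN normCi.
rewrite mul1r in E1; rewrite mulN1r in E2; rewrite mulNr in E4.
have [y [z [y0 zlt0 yz]]] :=
  exists_hyperbolic (mxform_sesquilinear _) e20 E1 E2 E3 E4.
pose ty := uncvec y.
have Ey : y = cvec ty by rewrite uncvecK.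
have nearty i (a : C) : 0 < a ->
    \forall t \near cube_filter ty, `|y i 0 - cvec t i 0| < a.
  by rewrite Ey; exact: near_cvec.
have [f [c0 [m [M [L [d [/Re_gt0E[{}m m0 ->] /Re_gt0E[{}L L0 ->]
  /Re_gt0E[{}d d0 ->]]]]]]]] :=
  near_zeros y0 zlt0 yz nearty.
move=> [r r0 H].
(* [near_zeros] does not assert that its upper bound is positive; the maximum with 1 does. *)
exists ty, z, f, c0, r, m, (Num.max 1 (complex.Re M)), L, d; split.
  by split => //; rewrite lt_max ltr01.
move=> t /H[ft hH]; split => // h hd.
have EX : (f t + h) *: z + cvec t =
    cvec (translate (uncvec ((f t + h) *: z)) t).
  by rewrite cvec_translate uncvecK.
have := hH h hd; cbv zeta; rewrite EX => -[N q]; split => //; move: N.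
rewrite mxform1_cvec lecR => /andP[-> ]; rewrite lecE /= => /andP[_ NM].
by rewrite le_max NM orbT.
Qed.
Lemma closed_disc_measurable (z0 : C) (e : R) :
  measurable ([set z : C | `|z - z0| <= e%:C] : set (@borelC R)).
Proof.
rewrite -[X in measurable X]setCK; apply: measurableC.
apply: sub_sigma_algebra; rewrite /= openE => z /= /negP ze.
have ze' : e%:C < `|z - z0|.
  rewrite real_ltNge ?normr_real//; last by rewrite complex_real.
apply/nbhs_ballP; exists (`|z - z0| - e%:C); first by rewrite /= subr_gt0.
move=> w; rewrite -ball_normE/= ltrBrDr => zw /= we.
have := le_lt_trans (ler_distD w z z0) (le_lt_trans (lerD (lexx _) we) zw).
by rewrite ltxx.
Qed.

Lemma grid_near (N : nat) (x : R) : (0 < N)%N -> `|x| <= 1 ->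
  exists2 k, k \in iota 0 (N.*2.+1) & `|k%:R / N%:R - 1 - x| <= N%:R^-1.
Proof.
move=> N0; rewrite ler_norml => /andP[x1 x2].
have N0' : 0 < N%:R :> R by rewrite ltr0n.
have y0 : 0 <= (x + 1) * N%:R by rewrite mulr_ge0 ?ler0n//; lra.
(* The node is the integer part of [(x + 1) * N], which ranges from 0 to 2N inclusive, hence 2N + 1
   nodes. *)
have /andP[k1 k2] := truncn_itv y0.
set k := Num.truncn _ in k1 k2.
have yN : (x + 1) * N%:R <= N.*2%:R.
  by rewrite -muln2 natrM mulrC ler_pM2l//; lra.
exists k; first by rewrite mem_iota/= add0n ltnS -(ler_nat R) (le_trans k1).
rewrite -(ler_pM2r N0') mulVf ?lt0r_neq0// -[X in _ * X]gtr0_norm// -normrM.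
rewrite !mulrBl divfK ?lt0r_neq0// mul1r ler_norml -natr1 in k2 *.
by apply/andP; split; lra.
Qed.


Lemma normc_ge_Im (c : C) : `|complex.Im c|%:C <= `|c|.
Proof. by rewrite normc_def lecR -sqrtr_sqr ler_wsqrtr// lerDr sqr_ge0. Qed.

Lemma translate_scale m (a : R) (w t : m.-tuple RR) :
  translate (scale_tuple a w) (scale_tuple a t) = scale_tuple a (translate w t).
Proof. by apply: eq_from_tnth => i; rewrite !tnth_mktuple mulrDr. Qed.

Lemma scale_tupleK m (a : R) (t : m.-tuple RR) : a != 0 ->
  scale_tuple a (scale_tuple a^-1 t) = t.
Proof. by move=> a0; apply: eq_from_tnth => i; rewrite !tnth_mktuple mulVKf. Qed.

(** The set whose volume, divided by that of the unit ball, is by definition the numerical measure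
    of the closed disc of radius [e] around [z0]. *)
Definition cone n (A : 'M[C]_n) (z0 : C) (e : R) : set ((n + n).-tuple RR) :=
  @eball R (n + n) `&` @radial R (n + n) @^-1`
    [set t | `|cinner (A *m cvec t) (cvec t) - z0| <= e%:C].

Lemma cone_measurable n (A : 'M[C]_n) z0 e : measurable (cone A z0 e).
Proof.
apply: measurableI; first exact: measurable_eball.
have := measurable_cinner_cvec A (@measurable_radial R (n + n)).
move=> /(_ measurableT _ (closed_disc_measurable z0 e)).
by rewrite setTI.
Qed.

Lemma cone_lower_bound n (A : 'M[C]_n) (z0 : C) : (numerical_range A)° z0 ->
  exists (b K : R), [/\ 0 < b, 0 < K & forall e, 0 < e <= 1 ->
    (b%:E <= ((K / e) ^+ 2)%:E * lebesgue_tuple (n + n) (cone A z0 e))%E].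
Proof.
move=> /interior_zeros[y [z [f [c0 [r [m [M [L [d [[r0 m0 M0 L0 d0] H]]]]]]]]]].
(* Vectors of squared norm at most [M] have norm at most [1 + M], so scaling by [a] brings them into
   the unit ball. *)
pose a := (1 + M)^-1; have a0 : 0 < a by rewrite invr_gt0 addr_gt0.
(* As N exceeds [K / e] and [e <= 1], the first term yields [L * (2 / N) / m <= e], the second
   [2 / N < d], and the last [1 <= K / e], used in counting the grid. *)
pose K := 2 * L / m + 2 / d + 1.
have K0 : 0 < K by rewrite !addr_gt0 ?divr_gt0 ?mulr_gt0.
have ar0 : 0 < a * r by rewrite mulr_gt0.
have [mB muB] := lebesgue_tuple_cube_at (scale_tuple a y) ar0.
exists ((a * r *+ 2) ^+ (n + n)), (6 * K); split.
- by rewrite exprn_gt0// mulrn_wgt0.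
- by rewrite mulr_gt0.
move=> e /andP[e0 e1]; rewrite -muB.
set B := [set t | _].
pose N := (Num.truncn (K / e)).+1.
have Ke0 : 0 <= K / e by rewrite divr_ge0 ?ltW.
have /andP[N1 N2] := truncn_itv Ke0.
have KKe : K <= K / e by rewrite ler_pdivlMr// ler_piMr ?(ltW K0).
have Lm0 : 0 < 2 * L / m by rewrite divr_gt0 ?mulr_gt0.
have d20 : 0 < 2 / d by rewrite divr_gt0.
have N0 : 0 < N%:R :> R by rewrite ltr0n.
have Nd : 2 / N%:R < d.
  rewrite ltr_pdivrMr// mulrC -ltr_pdivrMr//; apply: lt_trans N2.
  by apply: lt_le_trans KKe; rewrite /K; lra.
have NL : L * (2 / N%:R) / m <= e.
  rewrite (_ : L * _ / m = 2 * L / m / N%:R); last by ring.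
  rewrite ler_pdivrMr// [leRHS]mulrC -ler_pdivrMr// ltW//; apply: le_lt_trans N2.
  by rewrite ler_pM2r ?invr_gt0// /K; lra.
pose pt (k : nat) : R := k%:R / N%:R - 1.
(* A square grid of mesh 1/N around [c0]: it reaches every root [f t], since these lie within
   distance 1 of [c0]. *)
pose s := [seq scale_tuple a (uncvec ((c0 + (pt k +i* pt l)) *: z)) |
  k <- iota 0 N.*2.+1, l <- iota 0 N.*2.+1].
apply: (@le_trans _ _
  ((size s)%:R%:E * lebesgue_tuple (n + n) (cone A z0 e))%E).
  apply: lebesgue_tuple_le_cover => //; first exact: cone_measurable.
  move=> t Bt; pose t' := scale_tuple a^-1 t.
  have t'y i : `|tnth t' i - tnth y i| <= r.
    rewrite -(ler_pM2l a0); apply: le_trans (Bt i); rewrite !tnth_mktuple.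
    rewrite -[X in X * `|_|](gtr0_norm a0) -normrM mulrBr mulVKf//.
    exact: lt0r_neq0.
  have [ft hX] := H t' t'y.
  rewrite distrC in ft.
  have [k ks hk] : exists2 k, k \in iota 0 N.*2.+1 &
      `|pt k - complex.Re (f t' - c0)| <= N%:R^-1.
    apply: grid_near => //; rewrite -lecR ltW//.
    exact: le_lt_trans (normc_ge_Re _) ft.
  have [l ls hl] : exists2 l, l \in iota 0 N.*2.+1 &
      `|pt l - complex.Im (f t' - c0)| <= N%:R^-1.
    apply: grid_near => //; rewrite -lecR ltW//.
    exact: le_lt_trans (normc_ge_Im _) ft.
  (* The rounding error of the root: each coordinate is at most 1/N in absolute value. *)
  pose h := c0 + (pt k +i* pt l) - f t'.
  have hN : `|h| <= (2 / N%:R)%:C.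
    apply: (le_trans (normc_le _)); rewrite lecR.
    apply: (le_trans _ (_ : N%:R^-1 + N%:R^-1 <= _)); last by lra.
    have hE (c g : C) (p q : R) : c + (p +i* q) - g =
        (p - complex.Re (g - c)) +i* (q - complex.Im (g - c)).
      case: c g => [? ?] [? ?]; apply/eqP; rewrite eq_complex /=.
      by apply/andP; split; apply/eqP; ring.
    by rewrite /h hE lerD.
  have hd : `|h| < d%:C by apply: (le_lt_trans hN); rewrite ltcR.
  have fh : f t' + h = c0 + (pt k +i* pt l) by rewrite /h addrC subrK.
  have [/andP[mX XM] qX] := hX _ hd.
  rewrite fh in mX XM qX.
  set X := translate _ t' in mX XM qX.
  exists (scale_tuple a (uncvec ((c0 + (pt k +i* pt l)) *: z))).
    by apply/allpairsP; exists (k, l).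
  rewrite -(scale_tupleK t (lt0r_neq0 a0)) -/t' translate_scale -/X.
  have X0 : enorm X != 0.
    by apply: contraTneq mX => ->; rewrite expr0n/= -ltNge.
  split; rewrite /= ?radial_scale//.
    rewrite /eball/= enorm_scale ?(ltW a0)// mulrC.
    rewrite ler_pdivrMr ?addr_gt0// mul1r.
    have M1 : 0 <= 1 + M by rewrite addr_ge0 ?(ltW M0).
    rewrite -ler_sqr ?nnegrE ?enorm_ge0//; apply: (le_trans XM).
    by rewrite sqrrD expr1n mul1r; nra.
  have X20 : 0 < enorm X ^+ 2 by exact: lt_le_trans mX.
  rewrite cinner_radial// normrM normfV [`|(enorm X ^+ 2)%:C|]gtr0_norm ?ltcR//.
  rewrite ler_pdivrMr ?ltcR//; apply: (le_trans qX).
  apply: (@le_trans _ _ (L%:C * (2 / N%:R)%:C)).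
    by rewrite ler_wpM2l// lecR ltW.
  rewrite -!rmorphM lecR; apply: (@le_trans _ _ (e * m)).
    by rewrite -ler_pdivrMr.
  by rewrite ler_wpM2l// ltW.
(* The grid has (2N + 1)^2 points, and N is at most [K / e + 1] with [K / e >= 1], so 2N + 1 is at
   most [6 * K / e]. *)
rewrite lee_wpmul2r// lee_fin size_allpairs size_iota.
rewrite natrM -expr2 ler_sqr ?nnegrE ?ler0n//; last first.
  by rewrite divr_ge0 ?mulr_ge0 ?ltW.
rewrite -mulrA (_ : N.*2.+1%:R = 2 * N%:R + 1 :> R); last first.
  by rewrite -natr1 -muln2 natrM mulrC.
have NE : N%:R = (Num.truncn (K / e))%:R + 1 :> R by rewrite natr1.
have : 1 <= K / e by apply: le_trans KKe; rewrite /K; lra.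
lra.
Qed.

End cone_volume.

(** * From the volume of the cone to the lower limit *)

Unset Implicit Arguments.

Theorem proposition2p6 (R : realType) (n : nat) (A : 'M[R[i]]_n) (z0 : R[i]) :
  (numerical_range A)° z0 ->
  (0 < limf_einf (fun e : R =>
         ((e ^+ 2)^-1)%:E *
         numerical_measure A [set z : R[i] | (`|z - z0| <= e%:C)%R]) 0^'+)%E.
Proof.
move=> /cone_lower_bound[b [K [b0 K0 bK]]].
pose V : R := fine (lebesgue_tuple (n + n) (@eball R (n + n))).
have V0 : 0 < V.
  by rewrite fine_gt0// lebesgue_tuple_eball_gt0 lebesgue_tuple_eball_lty.
(* The cone has volume at least [b * e ^+ 2 / K ^+ 2]; dividing by the ball volume [V] and by
   [e ^+ 2] leaves this constant. *)
have c0 : 0 < b / K ^+ 2 / V by rewrite !divr_gt0// exprn_gt0.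
apply: (@lt_le_trans _ _ (b / K ^+ 2 / V)%:E); first by rewrite lte_fin.
rewrite limf_einfE.
(* The lower limit is a supremum of infima over the sets of the filter, so a bound on the single set
   of [e] with [0 < e <= 1] suffices. *)
apply: (le_trans _ (ereal_sup_ubound _)); last first.
  exists [set e : R | 0 < e <= 1]; last by reflexivity.
  exists 1 => //= e /=; rewrite sub0r normrN => e1 e0.
  by rewrite e0 ltW// (le_lt_trans (ler_norm _)).
apply: le_ereal_inf_tmp => _ [e e01 <-].
have e0 : 0 < e by case/andP: e01.
have -> : numerical_measure A [set z : R[i] | (`|z - z0| <= e%:C)%R] =
  (lebesgue_tuple (n + n) (cone A z0 e) * V^-1%:E)%E by [].
have := bK _ e01.
rewrite muleA; set mu := lebesgue_tuple _ _ => bmu.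
rewrite EFinM; apply: lee_wpmul2r; first by rewrite lee_fin invr_ge0 ltW.
rewrite -(@lee_pmul2l _ (K ^+ 2)%:E) ?fin_numE// ?lte_fin ?exprn_gt0//.
rewrite muleA -!EFinM mulrC divfK ?gt_eqF ?exprn_gt0//.
by rewrite (_ : K ^+ 2 * _ = (K / e) ^+ 2)// expr_div_n.
Qed.
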